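(* Let $p>2$, $H>0$, $0<\varphi<\pi/2$, $f\in L^1(-1,1)$, and let $u\in W_0^{1,p}(-1,1)$ be a weak solution to problem (P). If $f\ge 0$ a.e. in $(-1,1)$, then $u\ge 0$ in $(-1,1)$.
   Context: Problem (P) is the boundary value problem $-\frac{d}{dx}\big[(u(x)+H)\,|u'(x)\cos\varphi+\sin\varphi|^{p-2}(u'(x)\cos\varphi+\sin\varphi)\big]=f(x)$ for $x\in(-1,1)$, $u(-1)=u(1)=0$. A weak solution to (P) is a function $u\in W_0^{1,p}(-1,1)$ with $u\ge -H$ such that $\int_{-1}^1 (u+H)|u'\cos\varphi+\sin\varphi|^{p-2}(u'\cos\varphi+\sin\varphi)\,v'\,dx=\int_{-1}^1 f v\,dx$ for all $v\in W_0^{1,p}(-1,1)$ (weak derivatives). Functions in $W^{1,p}_0(-1,1)$ are identified with their absolutely continuous representatives on $[-1,1]$. *)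

(* Defs.v *)
From mathcomp Require Import all_boot all_order all_algebra.
From mathcomp Require Import all_classical all_reals all_analysis.

Set Implicit Arguments.
Unset Strict Implicit.
Unset Printing Implicit Defensive.

Import Order.TTheory GRing.Theory Num.Theory.
Import numFieldNormedType.Exports.

Local Open Scope classical_set_scope.
Local Open Scope ring_scope.

Section sobolev.
Context {R : realType}.
Implicit Types (p a b H phi : R) (f g u v du dv : R -> R).

Local Notation mu := (@lebesgue_measure R).

(* A function on an open interval is a total function R -> R of which only the
   values on that interval matter, hence the restrictions [f \_ `]a, b[], which
   are extended by 0. *)
Definition Lp p a b f : Prop := f \_ `]a, b[ \in Lfun mu p%:E.

Definition Lp_norm p a b f : \bar R := 'N[mu]_p%:E[EFin \o (f \_ `]a, b[)]%E.

Definition abs_continuous a b f : Prop :=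
  forall e : R, 0 < e -> exists2 d : R, 0 < d &
    forall (n : nat) (s t : 'I_n -> R),
      (forall i, [/\ a <= s i, s i < t i & t i <= b]) ->
      trivIset setT (fun i => `]s i, t i[%classic) ->
      \sum_(i < n) (t i - s i) < d ->
      \sum_(i < n) `|f (t i) - f (s i)| < e.

Definition C1c a b f : Prop :=
  [/\ forall x : R, derivable f x 1,
      continuous (derive1 f),
      compact (closure [set x | f x != 0]) &
      closure [set x | f x != 0] `<=` `]a, b[].

Definition weak_derivative a b u g : Prop :=
  [/\ locally_integrable `]a, b[ u,
      locally_integrable `]a, b[ g &
      forall h, C1c a b h ->
        \int[mu]_(x in `]a, b[) (u x * derive1 h x) =
        - \int[mu]_(x in `]a, b[) (g x * h x)].

(* W_0^{1,p}(a, b) is the closure of C_c^1(a, b) in W^{1,p}(a, b), as in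
   H. Brezis, Functional Analysis, Sobolev Spaces and PDEs, Chapter 8; its
   elements are given by their representatives that are absolutely continuous
   on [a, b]. [W1p p a b u du] says that u is in W^{1,p}(a, b) and that du is a
   version of its weak derivative. *)
Definition W1p p a b u du : Prop :=
  [/\ Lp p a b u, weak_derivative a b u du & Lp p a b du].

Definition W1p_dist p a b u du f : \bar R :=
  (Lp_norm p a b (fun x => u x - f x)%R
   + Lp_norm p a b (fun x => du x - derive1 f x)%R)%E.

Definition W01p p a b u : Prop :=
  abs_continuous a b u /\
  exists2 du, W1p p a b u du &
    forall e : R, 0 < e ->
      exists2 f, C1c a b f & (W1p_dist p a b u du f < e%:E)%E.

(* [du] and [dv] range over all versions of the weak derivatives u' and v',
   which are unique up to a null set. *)
Definition weak_solution p H phi f u : Prop :=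
  [/\ W01p p (-1) 1 u,
      forall x : R, x \in `]-1, 1[ -> - H <= u x &
      forall du, weak_derivative (-1) 1 u du ->
      forall v dv, W01p p (-1) 1 v -> weak_derivative (-1) 1 v dv ->
        \int[mu]_(x in `]-1, 1[)
          ((u x + H) * `|du x * cos phi + sin phi| `^ (p - 2)
           * (du x * cos phi + sin phi) * dv x) =
        \int[mu]_(x in `]-1, 1[) (f x * v x)].

End sobolev.

(* Main.v *)
(* The weak formulation is tested with v = G(u), where G(0) = 0 and G' is the
   tent max(0, min(-t, t + H)), supported in [-H, 0]; then G <= 0, so the right
   hand side is <= 0.  Put Phi(z) = |z|^(p-2) z, s = sin(phi) and
   K' = (t + H) G', K(0) = 0.  The left hand side is the integral of

     K'(u) (Phi(u' cos(phi) + s) - Phi(s)) u'  +  Phi(s) K'(u) u'.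

   The second term is Phi(s) (K(u))' and integrates to 0 since u vanishes at the
   end points; the first one is nonnegative by monotonicity of Phi, and hence
   vanishes almost everywhere.  As Phi is injective, (K(u))' = 0 almost
   everywhere, so K(u) = K(0) on ]-1, 1[.  But K is strictly increasing on
   [-H, 0] and u >= -H, so u cannot be negative.

   The chain rule is obtained by density: if f -> u with f in C_c^1, then
   f -> u uniformly (f(x) is the integral of f' over ]a, x[), so G(f) -> G(u)
   in W^{1,p} as soon as G' is bounded and Lipschitz. *)
Require Import Defs.
From mathcomp Require Import all_boot all_order all_algebra.
From mathcomp Require Import all_classical all_reals all_analysis.
From mathcomp Require Import measurable_realfun.
From mathcomp Require Import ring lra.
Import Order.TTheory GRing.Theory Num.Theory.
Import numFieldNormedType.Exports.
Local Open Scope classical_set_scope.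
Local Open Scope ring_scope.

Lemma measurable_norm_powR {R : realType} (A : set R) (k : R -> R) (r : R) :
  measurable_fun A k -> measurable_fun A (fun x => `|k x| `^ r).
Proof.
move=> mk; apply: (@measurableT_comp _ _ _ _ _ _ (@powR R ^~ r)) => //.
exact: measurableT_comp.
Qed.

Lemma lebesgue_measure_oo_lty {R : realType} (a b : R) :
  (lebesgue_measure `]a, b[%classic < +oo)%E.
Proof.
rewrite lebesgue_measure_itv/=.
by case: ifPn => // _; rewrite -EFinB ltry.
Qed.

Lemma measurable_restrict_oo {R : realType} (a b : R) (k : R -> R) :
  measurable_fun `]a, b[ k <-> measurable_fun setT (k \_ `]a, b[).
Proof. exact: measurable_restrictT. Qed.

(** * The spaces L^p on a bounded open interval *)

Section Lp_interval.
Context {R : realType}.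
Variables (p a b : R).
Hypothesis p1 : 1 < p.
Implicit Types (k l : R -> R) (c : R).

Local Notation mu := (@lebesgue_measure R).
Local Notation D := `]a, b[%classic.

Lemma LpP k : Lp p a b k <->
  measurable_fun D k /\ (Lp_norm p a b k < +oo)%E.
Proof.
rewrite /Lp inE; split.
  by move=> /andP[/[!inE]/= mk nk]; split => //; exact/measurable_restrict_oo.
move=> [mk nk]; apply/andP; split; rewrite inE//=.
exact/measurable_restrict_oo.
Qed.

Lemma Lp_norm_ge0 k : (0 <= Lp_norm p a b k)%E.
Proof. exact: Lnorm_ge0. Qed.

Lemma Lp_integrable_powR k : Lp p a b k ->
  mu.-integrable D (fun x => (`|k x| `^ p)%:E).
Proof.
move=> /(Lfun_integrable (ltW p1)) h.
apply/integrable_mkcond => //; congr (_.-integrable _ _): h.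
apply/funext => x; rewrite !patchE; case: ifPn => // _.
by rewrite normr0 powR0// gt_eqF// (lt_trans _ p1).
Qed.

Lemma Lp_norm_le k l : measurable_fun D k -> measurable_fun D l ->
  (forall x, D x -> `|k x| <= `|l x|) ->
  (Lp_norm p a b k <= Lp_norm p a b l)%E.
Proof.
move=> mk ml kl; have p0 : 0 < p by exact: lt_trans p1.
rewrite /Lp_norm unlock.
apply: gt0_ler_poweR.
- by rewrite invr_ge0 ltW.
- by rewrite in_itv/= leey andbT integral_ge0// => x _; exact: poweR_ge0.
- by rewrite in_itv/= leey andbT integral_ge0// => x _; exact: poweR_ge0.
- apply: ge0_le_integral => //.
  + by move=> x _; exact: poweR_ge0.
  + by have /measurable_restrict_oo/(measurable_norm_powR _ _ p)/measurable_EFinP := mk.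
  + by have /measurable_restrict_oo/(measurable_norm_powR _ _ p)/measurable_EFinP := ml.
  + move=> x _ /=; rewrite lee_fin ge0_ler_powR ?nnegrE ?(ltW p0)//.
    by rewrite !patchE; case: ifPn => // /[!inE]; exact: kl.
Qed.

Lemma Lp_normZ c k : Lp p a b k ->
  (Lp_norm p a b (fun x => c * k x)%R = `|c|%:E * Lp_norm p a b k)%E.
Proof.
move=> Lk; have p1' : (1%:E <= p%:E)%E by rewrite lee_fin ltW.
have := LnormZ (Lfun_Sub p1' Lk) c.
rewrite /Lp_norm => <-; apply: eq_Lnorm => x /=.
by congr EFin; rewrite !patchE; case: ifPn => //; rewrite scaler0.
Qed.

Lemma Lp_normD k l : measurable_fun D k -> measurable_fun D l ->
  (Lp_norm p a b (fun x => k x + l x)%R <= Lp_norm p a b k + Lp_norm p a b l)%E.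
Proof.
move=> mk ml; have p1' : (1%:E <= p%:E)%E by rewrite lee_fin ltW.
rewrite /Lp_norm.
rewrite (_ : (fun x => k x + l x) \_ D = k \_ D \+ l \_ D).
  by apply: eminkowski => //; exact/measurable_restrict_oo.
by apply/funext => x /=; rewrite !patchE; case: ifPn => //; rewrite addr0.
Qed.

Lemma LpZ c k : Lp p a b k -> Lp p a b (fun x => c * k x).
Proof.
move=> Lk; have [mk nk] := (LpP k).1 Lk.
by apply/LpP; split; [exact: measurable_funM|rewrite Lp_normZ// lte_mul_pinfty].
Qed.

Lemma LpD k l : Lp p a b k -> Lp p a b l -> Lp p a b (fun x => k x + l x).
Proof.
move=> /LpP[mk nk] /LpP[ml nl]; apply/LpP; split; first exact: measurable_funD.
by rewrite (le_lt_trans (Lp_normD _ _ mk ml))// lte_add_pinfty.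
Qed.

Lemma LpB k l : Lp p a b k -> Lp p a b l -> Lp p a b (fun x => k x - l x).
Proof.
move=> Lk /(LpZ (-1)) Ll; have := LpD _ _ Lk Ll.
by under [X in Lp _ _ _ X]eq_fun do rewrite mulN1r.
Qed.

(** Two dominating functions are allowed because the chain rule splits an error into a multiple of
    [du - f'] and a multiple of [du]; a single bound is the case [c2 = 0]. *)
Lemma Lp_dominated (c1 c2 : R) k l1 l2 : measurable_fun D k ->
  Lp p a b l1 -> Lp p a b l2 -> 0 <= c1 -> 0 <= c2 ->
  (forall x, D x -> `|k x| <= c1 * `|l1 x| + c2 * `|l2 x|) ->
  Lp p a b k /\
  (Lp_norm p a b k <= c1%:E * Lp_norm p a b l1 + c2%:E * Lp_norm p a b l2)%E.
Proof.
move=> mk L1 L2 c10 c20 h.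
have abs l : Lp p a b l ->
    Lp p a b (fun x => `|l x|) /\ Lp_norm p a b (fun x => `|l x|) = Lp_norm p a b l.
  move=> /LpP[ml nl]; have ma : measurable_fun D (fun x => `|l x|).
    exact: measurableT_comp.
  have E : Lp_norm p a b (fun x => `|l x|) = Lp_norm p a b l.
    by apply/eqP; rewrite eq_le !Lp_norm_le// => x _ /=; rewrite normr_id.
  by split => //; apply/LpP; rewrite E.
have [A1 E1] := abs _ L1; have [A2 E2] := abs _ L2.
have [m1 n1] := (LpP _).1 (LpZ c1 _ A1); have [m2 n2] := (LpP _).1 (LpZ c2 _ A2).
have le : (Lp_norm p a b k <=
    c1%:E * Lp_norm p a b l1 + c2%:E * Lp_norm p a b l2)%E.
  have h1 : (Lp_norm p a b k <=
      Lp_norm p a b (fun x => c1 * `|l1 x| + c2 * `|l2 x|)%R)%E.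
    apply: Lp_norm_le => //; first exact: measurable_funD.
    by move=> x Dx; rewrite (le_trans (h x Dx))// ler_norm.
  rewrite (le_trans h1)// (le_trans (Lp_normD _ _ m1 m2))//.
  by rewrite !Lp_normZ// E1 E2 !ger0_norm.
split => //; apply/LpP; split => //; apply: le_lt_trans le _.
by rewrite lte_add_pinfty// lte_mul_pinfty// ((LpP _).1 _).2.
Qed.

Lemma Lp_cst c : Lp p a b (cst c).
Proof.
suff L1 : Lp p a b (cst 1).
  by have := LpZ c _ L1; under [X in Lp _ _ _ X]eq_fun do rewrite /= mulr1.
apply/LpP; split; first exact: measurable_cst.
rewrite /Lp_norm unlock poweR_lty//.
(* The p-th power of 1 extended by 0 is the indicator of the interval; here [p != 0] matters, since
   0 to the power 0 is 1. *)
rewrite [ltLHS](_ : _ = \int[mu]_(x in D) (cst 1%E x))%E.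
  by rewrite integral_cst// mul1e; exact: lebesgue_measure_oo_lty.
rewrite [RHS]integral_mkcond; apply: eq_integral => x _ /=.
rewrite !patchE; case: ifPn => _; rewrite ?normr1 ?powR1//.
by rewrite normr0 powR0// gt_eqF// (lt_trans _ p1).
Qed.

Lemma Lp_bounded c k : measurable_fun D k ->
  (forall x, D x -> `|k x| <= c) -> Lp p a b k.
Proof.
move=> mk kc; have L1 := Lp_cst 1.
apply: (proj1 (Lp_dominated `|c| 0 _ _ _ mk L1 L1 _ _ _)) => //= x Dx.
by rewrite mul0r addr0 normr1 mulr1 (le_trans (kc x Dx))// ler_norm.
Qed.

End Lp_interval.

(* Hoelder's inequality against the indicator of the interval. *)
Lemma Lp_norm_L1 {R : realType} (p a b : R) : 1 < p ->
  exists2 C : R, 0 < C & forall k : R -> R, Lp p a b k ->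
  lebesgue_measure.-integrable `]a, b[ (EFin \o k) /\
  forall e : R, (Lp_norm p a b k < e%:E)%E ->
    \int[lebesgue_measure]_(x in `]a, b[) `|k x| <= C * e.
Proof.
move=> p1; have p0 : 0 < p by exact: lt_trans p1.
pose q := (1 - p^-1)^-1.
have ip : p^-1 < 1 by rewrite invf_lt1.
have q1 : 1 < q by rewrite /q invf_gt1 ?subr_gt0// gtrBl invr_gt0.
have q0 : 0 < q by exact: lt_trans q1.
have pq : p^-1 + q^-1 = 1 by rewrite /q invrK addrC subrK.
have /LpP[m1 N1y] := Lp_cst q a b q1 1.
set N1 := Lp_norm q a b (cst 1) in N1y.
have N10 : (0 <= N1)%E by exact: Lp_norm_ge0.
have N1E : N1 = (fine N1)%:E by rewrite fineK// ge0_fin_numE.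
(* The added 1 keeps the constant positive when the interval is empty and [N1] is 0. *)
exists (fine N1 + 1); first by rewrite ltr_wpDl// fine_ge0.
move=> k /LpP[mk nk].
have H : (\int[lebesgue_measure]_(x in `]a, b[) `|k x|%:E
    <= Lp_norm p a b k * N1)%E.
  have mrk := (measurable_restrict_oo a b k).1 mk.
  have mr1 : measurable_fun setT ((cst 1 : R -> R) \_ `]a, b[).
    exact/measurable_restrict_oo.
  apply: le_trans (hoelder lebesgue_measure mrk mr1 p0 q0 pq).
  rewrite Lnorm1 [leLHS]integral_mkcond le_eqVlt; apply/orP; left; apply/eqP.
  apply: eq_integral => x _ /=; rewrite !patchE; case: ifPn => _.
    by rewrite mulr1.
  by rewrite mulr0 normr0.
have Hy : (\int[lebesgue_measure]_(x in `]a, b[) `|k x|%:E < +oo)%E.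
  apply: le_lt_trans H _.
  by rewrite lte_mul_pinfty// ?ge0_fin_numE// Lp_norm_ge0.
split; first by apply/integrableP; split; first exact/measurable_EFinP.
move=> e ke.
have e0 : 0 < e by rewrite -lte_fin (le_lt_trans _ ke)// Lp_norm_ge0.
rewrite -lee_fin fineK; last first.
  by rewrite ge0_fin_numE//; apply: integral_ge0 => x _; rewrite lee_fin.
apply: le_trans H _; rewrite N1E (le_trans (lee_wpmul2r _ (ltW ke)))//.
  by rewrite lee_fin fine_ge0.
by rewrite -EFinM lee_fin mulrC ler_wpM2r ?ltW// ltrDl.
Qed.

(** * Continuously differentiable functions with compact support *)

Section C1c.
Context {R : realType}.
Variables (a b : R).
Implicit Types (f g h G : R -> R) (x : R).

Local Notation mu := (@lebesgue_measure R).
Local Notation D := `]a, b[%classic.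

Lemma continuous_bounded_oo f : continuous f ->
  exists2 M, 0 <= M & forall x, D x -> `|f x| <= M.
Proof.
move=> cf; have [ab|ba] := leP a b; last first.
  exists 0 => // x /=; rewrite in_itv/= => /andP[ax xb].
  by have := lt_trans (lt_trans ax xb) ba; rewrite ltxx.
have cn : {within `[a, b], continuous (fun x => `|f x|)}.
  apply: continuous_subspaceT => x; apply: continuous_comp; first exact: cf.
  exact: norm_continuous.
have [c _ hc] := EVT_max ab cn.
by exists `|f c| => // x Dx; apply: hc; exact: subset_itv_oo_cc Dx.
Qed.

Lemma continuous_integrable_cc f : continuous f ->
  mu.-integrable `[a, b] (EFin \o f).
Proof.
move=> cf; apply: continuous_compact_integrable; first exact: segment_compact.
exact: continuous_subspaceT.
Qed.

Lemma Rintegral_oo_cc f : continuous f ->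
  \int[mu]_(x in D) f x = \int[mu]_(x in `[a, b]) f x.
Proof.
move=> /continuous_integrable_cc cf.
rewrite Rintegral_itv_bndo_bndc; last first.
  by apply: integrableS cf => //; exact: subset_itv_oo_cc.
rewrite Rintegral_itv_obnd_cbnd//.
by apply: integrableS cf => //; exact: subset_itv_oc_cc.
Qed.

Lemma C1c_derive f x : C1c a b f -> is_derive x 1 f ((derive1 f) x).
Proof. by move=> [df _ _ _]; rewrite derive1E; exact: derivableP. Qed.

Lemma C1c_continuous f : C1c a b f -> continuous f.
Proof.
by move=> [df _ _ _] x; apply: differentiable_continuous; exact/derivable1_diffP.
Qed.

Lemma C1c_eq0 f x : C1c a b f -> ~ D x -> f x = 0.
Proof.
move=> [_ _ _ sub] Dx; apply/eqP; apply: contra_notT Dx => fx.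
by apply: sub; exact: subset_closure.
Qed.

Lemma C1c_LR f x : C1c a b f -> derivable_oo_LRcontinuous f a x.
Proof.
move=> Cf; have cf := C1c_continuous _ Cf; case: Cf => df _ _ _; split.
- by move=> y _; exact: df.
- by apply: cvg_at_right_filter; exact: cf.
- by apply: cvg_at_left_filter; exact: cf.
Qed.

(** Since [G 0 = 0], the support of [G \o f] stays inside that of [f], hence remains compact in the
    interval. *)
Lemma C1c_comp f G g : (forall x : R, is_derive x 1 G (g x)) -> continuous g ->
  G 0 = 0 -> C1c a b f ->
  C1c a b (G \o f) /\ derive1 (G \o f) = (fun x => g (f x) * (derive1 f) x).
Proof.
move=> dG cg G0 Cf.
have dGf x : is_derive x 1 (G \o f) (g (f x) * (derive1 f) x).
  by apply: is_derive1_comp; exact: C1c_derive.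
have E : derive1 (G \o f) = (fun x => g (f x) * (derive1 f) x).
  by apply/funext => x; rewrite derive1E derive_val.
have cf := C1c_continuous _ Cf; case: Cf => df cf' kf sf.
have sub : closure [set x | (G \o f) x != 0] `<=` closure [set x | f x != 0].
  apply: closureS => x /=; apply: contra => /eqP ->.
  by rewrite G0.
split=> //; split.
- by move=> x; have [] := dGf x.
- rewrite E => x; apply: cvgM; last exact: cf'.
  by apply: continuous_comp; [exact: cf|exact: cg].
- by apply: subclosed_compact sub => //; exact: closed_closure.
- exact: subset_trans sub sf.
Qed.

End C1c.

(** The value at [a] drops out, because the support lies in the open interval. *)
Lemma C1c_FTC {R : realType} (a b x : R) (f : R -> R) : C1c a b f -> a < x ->
  \int[lebesgue_measure]_(t in `]a, x[) (derive1 f) t = f x.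
Proof.
move=> Cf ax; have cf' : continuous (derive1 f) by case: Cf.
rewrite Rintegral_oo_cc// /Rintegral (continuous_FTC2 ax _ (C1c_LR _ _ _ _ Cf))//.
  by rewrite -EFinB/= (C1c_eq0 a b f a)// ?subr0//= in_itv/= ltxx.
exact: continuous_subspaceT.
Qed.

Lemma C1c_integration_by_parts {R : realType} (a b : R) (f h : R -> R) :
  C1c a b f -> C1c a b h ->
  \int[lebesgue_measure]_(x in `]a, b[) (f x * (derive1 h) x) =
  - \int[lebesgue_measure]_(x in `]a, b[) ((derive1 f) x * h x).
Proof.
move=> Cf Ch; have [ab|ba] := ltP a b; last first.
  by rewrite set_itv_ge ?bnd_simp -?leNgt// !Rintegral_set0 oppr0.
have cf' : continuous (derive1 f) by case: Cf.
have ch' : continuous (derive1 h) by case: Ch.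
have cf := C1c_continuous _ _ _ Cf; have ch := C1c_continuous _ _ _ Ch.
rewrite Rintegral_oo_cc; last by move=> x; apply: cvgM; [exact: cf|exact: ch'].
rewrite Rintegral_oo_cc; last by move=> x; apply: cvgM; [exact: cf'|exact: ch].
rewrite (@Rintegration_by_parts R f h (derive1 f) (derive1 h) a b)//.
- by rewrite !(C1c_eq0 a b f)/= ?in_itv/= ?ltxx ?andbF// !mul0r subrr add0r.
- exact: continuous_subspaceT.
- exact: C1c_LR Cf.
- exact: continuous_subspaceT.
- exact: C1c_LR Ch.
Qed.

Lemma C1c_Lp {R : realType} (p a b : R) (f : R -> R) : 1 < p -> C1c a b f ->
  Lp p a b f /\ Lp p a b (derive1 f).
Proof.
move=> p1 Cf; have cf' : continuous (derive1 f) by case: Cf.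
have L (k : R -> R) : continuous k -> Lp p a b k.
  move=> ck; have [M _ kM] := continuous_bounded_oo a b k ck.
  apply: Lp_bounded kM => //; apply: measurable_funS (continuous_measurable_fun ck) => //.
by split; apply: L => //; exact: C1c_continuous Cf.
Qed.

(* [W01p_pair p a b u du] says that (u, du) is the limit of pairs (f, f') with
   f in C_c^1; du is then automatically a weak derivative of u. *)
Definition W01p_pair {R : realType} (p a b : R) (u du : R -> R) : Prop :=
  [/\ Lp p a b u, Lp p a b du &
    forall e : R, 0 < e -> exists2 f, C1c a b f &
      (Lp_norm p a b (fun x => u x - f x)%R < e%:E)%E /\
      (Lp_norm p a b (fun x => du x - derive1 f x)%R < e%:E)%E].

Lemma W01p_pairP {R : realType} (p a b : R) (u : R -> R) : W01p p a b u ->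
  exists2 du, weak_derivative a b u du & W01p_pair p a b u du.
Proof.
move=> [_ [du [Lu wu Ldu] ap]]; exists du => //; split => // e /ap[f Cf fe].
exists f => //; split; apply: le_lt_trans fe.
  by rewrite leeDl// Lp_norm_ge0.
by rewrite leeDr// Lp_norm_ge0.
Qed.

Lemma le_Rintegral_subset d (T : measurableType d) (R : realType)
    (mu : {measure set T -> \bar R}) (A B : set T) (k : T -> R) :
  measurable A -> measurable B -> A `<=` B ->
  mu.-integrable B (EFin \o k) -> (forall x, B x -> 0 <= k x) ->
  \int[mu]_(x in A) k x <= \int[mu]_(x in B) k x.
Proof.
move=> mA mB AB ik k0; rewrite /Rintegral fine_le//.
- by apply: integrable_fin_num => //; exact: integrableS ik.
- exact: integrable_fin_num.
- apply: ge0_subset_integral => //.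
  by case/integrableP : ik.
Qed.

Lemma le_normr_Rintegral_subset d (T : measurableType d) (R : realType)
    (mu : {measure set T -> \bar R}) (A B : set T) (k : T -> R) :
  measurable A -> measurable B -> A `<=` B ->
  mu.-integrable B (EFin \o k) ->
  `|\int[mu]_(x in A) k x| <= \int[mu]_(x in B) `|k x|.
Proof.
move=> mA mB AB ik.
have ikA : mu.-integrable A (EFin \o k) by exact: integrableS ik.
rewrite (le_trans (le_normr_Rintegral mA ikA))//.
apply: le_Rintegral_subset => //; exact: integrable_norm ik.
Qed.

(** * Limits of C_c^1 functions as primitives *)

Section W01p_pair.
Context {R : realType}.
Variables (p a b : R).
Hypothesis p1 : 1 < p.
Implicit Types (u du f g G : R -> R).

Local Notation mu := (@lebesgue_measure R).
Local Notation D := `]a, b[%classic.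

(** As [f] is the integral of [f'], the difference is the integral of [f' - du] over a subinterval,
    and Hoelder's inequality applies. The constant does not depend on [x], so L^p closeness of
    derivatives becomes uniform closeness. *)
Lemma C1c_primitive_close du : Lp p a b du -> exists2 C, 0 < C &
  forall f e, C1c a b f ->
    (Lp_norm p a b (fun x => du x - derive1 f x)%R < e%:E)%E ->
    forall x, a < x -> x <= b -> `|f x - \int[mu]_(t in `]a, x[) du t| <= C * e.
Proof.
move=> Ldu; have [C C0 HC] := Lp_norm_L1 p a b p1; exists C => // f e Cf fe x ax xb.
have [_ Lf'] := C1c_Lp p a b f p1 Cf.
have [idf /(_ _ fe) Ce] := HC _ (LpB p a b p1 _ _ Ldu Lf').
have [idu _] := HC _ Ldu; have [if' _] := HC _ Lf'.
have sub : `]a, x[ `<=` D by apply: subset_itvl; rewrite bnd_simp.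
rewrite -(C1c_FTC a b x f Cf ax) distrC -RintegralB//; last 2 first.
  exact: integrableS idu.
  exact: integrableS if'.
apply: le_trans Ce; apply: le_normr_Rintegral_subset => //.
Qed.

(** The uniform estimate is taken at [x = b], where every approximant vanishes. *)
Lemma W01p_pair_Rintegral0 u du : a < b -> W01p_pair p a b u du ->
  \int[mu]_(t in D) du t = 0.
Proof.
move=> ab [Lu Ldu ap]; have [C C0 HC] := C1c_primitive_close _ Ldu.
apply/eqP; rewrite -normr_le0; apply/ler_addgt0Pl => e e0; rewrite addr0.
have [f Cf [_ fe]] := ap (e / C) (divr_gt0 e0 C0).
have := HC f _ Cf fe b ab (lexx b).
rewrite (C1c_eq0 a b f b Cf) /= ?in_itv/= ?ltxx ?andbF//.
by rewrite sub0r normrN mulrCA divff ?mulr1// gt_eqF.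
Qed.

(** The approximants converge uniformly to the primitive [w] of [du] and in L^1 to [u]. If [u] and
    [w] differed at a point, continuity would keep [u] away from the approximants on a whole
    neighbourhood, against L^1 convergence. *)
Lemma W01p_pair_primitive u du : W01p_pair p a b u du ->
  (forall x, D x -> {for x, continuous u}) ->
  forall x, D x -> u x = \int[mu]_(t in `]a, x[) du t.
Proof.
move=> [Lu Ldu ap] cu x0 Dx0.
have [C C0 HC] := C1c_primitive_close _ Ldu.
have [C' C'0 HC'] := Lp_norm_L1 p a b p1.
pose w x := \int[mu]_(t in `]a, x[) du t.
apply/eqP; rewrite -subr_eq0; apply/negPn/negP => uw0.
pose d := `|u x0 - w x0|; have d0 : 0 < d by rewrite normr_gt0.
have wf f e x : C1c a b f ->
    (Lp_norm p a b (fun x => du x - derive1 f x)%R < e%:E)%E -> D x ->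
    `|f x - w x| <= C * e.
  by move=> Cf fe /=; rewrite in_itv/= => /andP[ax xb]; apply: HC => //; exact: ltW.
(* A first approximant [f1], continuous and uniformly within [d / 8] of [w], stands in for the
   continuity of [w]. *)
have e10 : 0 < d / 8 / C by rewrite !divr_gt0.
have [f1 Cf1 [_ fe1]] := ap _ e10.
have w1 x : D x -> `|f1 x - w x| <= d / 8.
  by move=> /(wf _ _ _ Cf1 fe1); rewrite mulrCA divff ?mulr1// gt_eqF.
have nbu : \forall x \near x0, `|u x0 - u x| < d / 8.
  by have /cvgrPdist_lt := cu x0 Dx0; apply; rewrite divr_gt0.
have nbf : \forall x \near x0, `|f1 x0 - f1 x| < d / 8.
  by have /cvgrPdist_lt := C1c_continuous _ _ _ Cf1 x0; apply; rewrite divr_gt0.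
have nbD : \forall x \near x0, D x by apply: near_in_itvoo.
have : \forall x \near x0, [/\ D x, `|u x0 - u x| < d / 8 & `|f1 x0 - f1 x| < d / 8].
  by near=> x; split; near: x.
move=> [r /= r0 rU].
pose U := `]x0 - r, x0 + r[%classic.
have {}rU x : U x -> [/\ D x, `|u x0 - u x| < d / 8 & `|f1 x0 - f1 x| < d / 8].
  move=> Ux; apply: rU; rewrite /ball_/= distrC.
  by move: Ux; rewrite /U/= in_itv/= ltr_distl.
have UD : U `<=` D by move=> x /rU[].
have m0 : 0 < d / 8 * r by rewrite mulr_gt0// divr_gt0.
(* The second approximant depends on the radius [r]: it must be within [d / 8] of [w] uniformly and
   within [d / 8 * r] of [u] in L^1. *)
have e20 : 0 < Num.min (d / 8 / C) (d / 8 * r / C').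
  by rewrite lt_min e10/= divr_gt0.
have [f Cf [fu fe]] := ap _ e20.
set e2 := Num.min _ _ in e20 fu fe.
have e2l : C * e2 <= d / 8.
  by rewrite mulrC -ler_pdivlMr// ge_min lexx.
have e2r : C' * e2 <= d / 8 * r.
  by rewrite mulrC -ler_pdivlMr// ge_min lexx orbT.
have [Lf _] := C1c_Lp p a b f p1 Cf.
have [iuf /(_ _ fu) up] := HC' _ (LpB p a b p1 _ _ Lu Lf).
have low x : U x -> d / 4 <= `|u x - f x|.
  move=> /rU[Dx ux fx].
  have h1 := w1 _ Dx; have h2 := w1 _ Dx0; have h3 := le_trans (wf _ _ _ Cf fe Dx) e2l.
  (* All terms except [u x - f x] are at most [d / 8], and there are five of them, so that one is at
     least [3 * d / 8]. *)
  have tri : d <= `|u x0 - u x| + `|u x - f x| + `|f x - w x| + `|f1 x - w x|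
      + `|f1 x0 - f1 x| + `|f1 x0 - w x0|.
    rewrite /d (_ : u x0 - w x0 = (u x0 - u x) + (u x - f x) + (f x - w x)
       - (f1 x - w x) - (f1 x0 - f1 x) + (f1 x0 - w x0)); last by ring.
    rewrite (le_trans (ler_normD _ _))// lerD2r.
    rewrite (le_trans (ler_normB _ _))// lerD2r.
    rewrite (le_trans (ler_normB _ _))// lerD2r.
    by rewrite (le_trans (ler_normD _ _))// lerD2r ler_normD.
  by lra.
have mU : measurable U by exact: measurable_itv.
have iufU : mu.-integrable U (EFin \o (fun x => `|u x - f x|)).
  by apply: integrableS (integrable_norm iuf).
have low' : d / 4 * (2 * r) <= \int[mu]_(x in U) `|u x - f x|.
  rewrite (_ : d / 4 * (2 * r) = \int[mu]_(x in U) (d / 4)); last first.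
    rewrite Rintegral_cst//; congr (_ * _).
    transitivity (fine (lebesgue_measure U)) => //.
    by rewrite lebesgue_measure_itv/= lte_fin ltrD2l gtrN//=; ring.
  apply: le_Rintegral => //.
  apply: measurable_bounded_integrable => //.
  - by rewrite lebesgue_measure_oo_lty.
  - exists (d / 4); split; rewrite ?num_real// => z zd x _ /=.
    by rewrite ger0_norm; [exact: ltW|rewrite divr_ge0// ltW].
have mid : \int[mu]_(x in U) `|u x - f x| <= \int[mu]_(x in D) `|u x - f x|.
  by apply: le_Rintegral_subset => //; exact: integrable_norm.
(* On [U], of length [2 * r], this forces [d * r / 2 <= d * r / 8], which is absurd. *)
have := le_trans low' (le_trans mid (le_trans up e2r)).
have := mulr_gt0 d0 r0; lra.
Unshelve. all: by end_near. Qed.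

End W01p_pair.

(** * Lipschitz maps and absolute continuity *)

Lemma is_derive_lipschitz {R : realType} (G g : R -> R) (M : R) :
  (forall x : R, is_derive x 1 G (g x)) -> (forall x, `|g x| <= M) ->
  forall x y, `|G x - G y| <= M * `|x - y|.
Proof.
move=> dG gM x y; wlog xy : x y / x < y => [H|].
  have [xy|yx|->] := ltgtP x y; first exact: H.
    by rewrite distrC (distrC x); exact: H.
  by rewrite !subrr normr0 mulr0.
have cG : {within `[x, y], continuous G}.
  apply: derivable_within_continuous => z _.
  by have [] := dG z.
have [c _ E] := MVT xy (fun z _ => dG z) cG.
by rewrite distrC (distrC x) E normrM ler_wpM2r.
Qed.

Lemma abs_continuous_comp {R : realType} (a b M : R) (G u : R -> R) :
  (forall x y, `|G x - G y| <= M * `|x - y|) ->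
  abs_continuous a b u -> abs_continuous a b (G \o u).
Proof.
move=> GM au e e0.
have M10 : 0 < `|M| + 1 by rewrite ltr_wpDl.
have [d d0 H] := au _ (divr_gt0 e0 M10).
exists d => // n s t st tr sd.
have {}H := H n s t st tr sd.
apply: (@le_lt_trans _ _ ((`|M| + 1) * \sum_(i < n) `|u (t i) - u (s i)|)).
  rewrite mulr_sumr; apply: ler_sum => i _ /=; apply: le_trans (GM _ _) _.
  by rewrite ler_wpM2r// (le_trans (ler_norm M))// lerDl.
by rewrite mulrC -ltr_pdivlMr.
Qed.

Lemma abs_continuous_continuous {R : realType} (a b : R) (u : R -> R) :
  abs_continuous a b u -> forall x, `]a, b[%classic x -> {for x, continuous u}.
Proof.
move=> au x Dx; apply/cvgrPdist_lt => e e0.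
have [d d0 H] := au e e0.
have nD : \forall y \near x, `]a, b[%classic y by apply: near_in_itvoo.
have nd : \forall y \near x, `|x - y| < d.
  by exists d => // y; rewrite /ball_.
(* Absolute continuity for a family consisting of one interval. *)
have one (s t : R) : `]a, b[%classic s -> `]a, b[%classic t -> s < t ->
    `|s - t| < d -> `|u t - u s| < e.
  rewrite /= !in_itv/= => /andP[as_ sb] /andP[at_ tb] st std.
  have := H 1%N (fun=> s) (fun=> t).
  rewrite !big_ord1; apply.
  - by move=> _; split => //; exact: ltW.
  - by move=> i j _ _ _; rewrite !ord1.
  - by rewrite -(ger0_norm (_ : 0 <= t - s)) ?subr_ge0 ?ltW// distrC.
near=> y.
have Dy : `]a, b[%classic y by near: y.
have yd : `|x - y| < d by near: y.
have [xy|yx|->] := ltgtP x y; last by rewrite subrr normr0.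
- by rewrite distrC; exact: one.
- by apply: one => //; rewrite distrC.
Unshelve. all: by end_near. Qed.

(** * Chain rule and weak derivatives for limits of C_c^1 functions *)

Section W01p_pair_comp.
Context {R : realType}.
Variables (p a b : R).
Hypothesis p1 : 1 < p.
Implicit Types (u du f g G : R -> R).

Local Notation mu := (@lebesgue_measure R).
Local Notation D := `]a, b[%classic.

(** If [f] approximates [u], then [G \o f] approximates [G \o u]: the bound [M] on [g] controls the
    values, and the derivatives are compared using also the Lipschitz bound [L] and the uniform
    closeness of [f] to [u]. *)
Lemma W01p_pair_comp (M L : R) G g u du :
  (forall x : R, is_derive x 1 G (g x)) -> G 0 = 0 ->
  (forall x, `|g x| <= M) -> (forall x y, `|g x - g y| <= L * `|x - y|) ->
  continuous g ->
  (forall x, D x -> {for x, continuous u}) ->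
  W01p_pair p a b u du -> W01p_pair p a b (G \o u) (fun x => g (u x) * du x).
Proof.
move=> dG G0 gM gL cg cu /[dup] W [Lu Ldu ap].
have M0 : 0 <= M by exact: le_trans (gM 0).
have L0 : 0 <= L by have := gL 1 0; rewrite subr0 normr1 mulr1; exact: le_trans.
have GM := is_derive_lipschitz _ _ _ dG gM.
have [mu_ _] := (LpP _ _ _ _).1 Lu; have [mdu ndu] := (LpP _ _ _ _).1 Ldu.
have cG : continuous G.
  move=> x; apply: differentiable_continuous; apply/derivable1_diffP.
  by have [] := dG x.
have mcomp (F k : R -> R) : continuous F -> measurable_fun D k ->
    measurable_fun D (F \o k).
  by move=> cF mk; apply: measurableT_comp => //; exact: continuous_measurable_fun.
have mGu : measurable_fun D (G \o u) by exact: mcomp.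
have mgu : measurable_fun D (fun x => g (u x) * du x).
  by apply: measurable_funM => //; exact: mcomp.
split.
- apply: (proj1 (Lp_dominated p a b p1 M 0 _ _ _ mGu Lu Lu M0 _ _)) => // x _.
  by rewrite mul0r addr0 /= -[X in `|X|]subr0 -{1}G0 (le_trans (GM _ _))// subr0.
- apply: (proj1 (Lp_dominated p a b p1 M 0 _ _ _ mgu Ldu Ldu M0 _ _)) => // x _.
  by rewrite mul0r addr0 normrM ler_wpM2r.
move=> e e0.
have [C C0 HC] := C1c_primitive_close _ _ _ p1 _ Ldu.
pose N := fine (Lp_norm p a b du).
have N0 : 0 <= N by rewrite fine_ge0// Lp_norm_ge0.
have NE : Lp_norm p a b du = N%:E by rewrite fineK// ge0_fin_numE// Lp_norm_ge0.
(* With [e' = e / K], the derivative error is at most [(M + L * C * N) * e']; the 1 leaves a margin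
   [e'] for the strict inequality. *)
pose K := M + L * C * N + 1.
have LCN : 0 <= L * C * N by rewrite !mulr_ge0// ltW.
have K0 : 0 < K by rewrite /K ltr_wpDl// addr_ge0.
have e'0 : 0 < e / K by rewrite divr_gt0.
have [f Cf [fu fdu]] := ap _ e'0.
set e' := e / K in e'0 fu fdu.
have eE : e = M * e' + L * C * N * e' + e'.
  by rewrite -[X in _ + X]mul1r -!mulrDl -/K /e' mulrCA divff ?mulr1// gt_eqF.
have [CGf dGf] := C1c_comp a b f G g dG cg G0 Cf.
have [Lf Lf'] := C1c_Lp p a b f p1 Cf.
have [LGf LGf'] := C1c_Lp p a b _ p1 CGf.
have uf x : D x -> `|u x - f x| <= C * e'.
  move=> Dx; rewrite distrC (W01p_pair_primitive _ _ _ p1 _ _ W cu x Dx).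
  by move: Dx; rewrite /= in_itv/= => /andP[ax xb]; apply: HC => //; exact: ltW.
have Luf := LpB p a b p1 _ _ Lu Lf.
have Lduf := LpB p a b p1 _ _ Ldu Lf'.
have LCe0 : 0 <= L * (C * e') by rewrite mulr_ge0// mulr_ge0 ?ltW.
exists (G \o f) => //; split.
- have mk : measurable_fun D (fun x => (G \o u) x - (G \o f) x).
    by apply: measurable_funB => //; exact: ((LpP _ _ _ _).1 LGf).1.
  have [|_ le] := Lp_dominated p a b p1 M 0 _ _ _ mk Luf Luf M0 (lexx 0).
    by move=> x _; rewrite mul0r addr0 GM.
  apply: le_lt_trans le _; rewrite mul0e adde0.
  apply: (@le_lt_trans _ _ (M * e')%:E).
    by rewrite EFinM lee_wpmul2l ?lee_fin// ltW.
  by rewrite lte_fin eE -addrA ltrDl ltr_wpDl// mulr_ge0// ltW.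
- have mk : measurable_fun D (fun x => g (u x) * du x - derive1 (G \o f) x).
    by apply: measurable_funB => //; exact: ((LpP _ _ _ _).1 LGf').1.
  have [|_ le] := Lp_dominated p a b p1 M (L * (C * e')) _ _ _ mk Lduf Ldu M0 LCe0.
    move=> x Dx; rewrite dGf.
    (* The first term is small in L^p because [g] is bounded, the second because [g (u x) - g (f x)]
       is uniformly small. *)
    rewrite (_ : _ - _ = g (f x) * (du x - derive1 f x) + (g (u x) - g (f x)) * du x).
      rewrite (le_trans (ler_normD _ _))// !normrM lerD// ler_wpM2r//.
      by rewrite (le_trans (gL _ _))// ler_wpM2l// uf.
    by ring.
  apply: le_lt_trans le _; rewrite NE -EFinM.
  apply: (@le_lt_trans _ _ (M * e' + L * (C * e') * N)%:E).
    by rewrite EFinD leeD2r// EFinM lee_wpmul2l ?lee_fin// ltW.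
  rewrite lte_fin eE (_ : L * (C * e') * N = L * C * N * e'); last by ring.
  by rewrite ltrDl.
Qed.

(** Integration by parts holds for each approximant, and for a fixed [h] both sides pass to the
    limit in L^1, as [h] and its derivative are bounded. *)
Lemma W01p_pair_weak_derivative u du :
  W01p_pair p a b u du -> weak_derivative a b u du.
Proof.
move=> [Lu Ldu ap].
have [C C0 HC] := Lp_norm_L1 p a b p1.
have [iu _] := HC _ Lu; have [idu _] := HC _ Ldu.
have oD : open D by exact: interval_open.
split; [exact: open_integrable_locally|exact: open_integrable_locally|].
move=> h Ch.
have ch := C1c_continuous _ _ _ Ch; have ch' : continuous (derive1 h) by case: Ch.
have [M1 M10 hM1] := continuous_bounded_oo a b _ ch.
have [M2 M20 hM2] := continuous_bounded_oo a b _ ch'.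
have mulb k l M : mu.-integrable D (EFin \o k) -> continuous l ->
    (forall x, D x -> `|l x| <= M) ->
    mu.-integrable D (EFin \o (fun x => k x * l x)) /\
    `|\int[mu]_(x in D) (k x * l x)| <= M * \int[mu]_(x in D) `|k x|.
  move=> ik cl lM.
  have mk : measurable_fun D k by case/integrableP : ik => /measurable_EFinP.
  have ink := integrable_norm ik.
  have iMk : mu.-integrable D (EFin \o (fun x => M * `|k x|)).
    by rewrite (_ : _ \o _ = (fun x => M%:E * (`|k x|)%:E)%E)//; exact: integrableZl.
  have ikl : mu.-integrable D (EFin \o (fun x => k x * l x)).
    apply: le_integrable iMk => //.
      apply/measurable_EFinP/measurable_funM => //.
      by apply: measurable_funTS; exact: continuous_measurable_fun.
    move=> x Dx /=; rewrite lee_fin !normrM normr_id mulrC ler_wpM2r//.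
    by rewrite (le_trans (lM x Dx))// ler_norm.
  split => //.
  rewrite -RintegralZl//.
  rewrite (le_trans (le_normr_Rintegral _ ikl))//.
  apply: le_Rintegral => //; first exact: integrable_norm.
  by move=> x Dx; rewrite normrM mulrC ler_wpM2r// lM.
have [iuh _] := mulb _ _ _ iu ch' hM2; have [iduh _] := mulb _ _ _ idu ch hM1.
apply/eqP; rewrite -subr_eq0 opprK -normr_le0.
apply/ler_addgt0Pl => e e0; rewrite addr0.
have K0 : 0 < (M1 + M2) * C + 1 by rewrite ltr_wpDl// mulr_ge0 ?addr_ge0// ltW.
have [f Cf [fu fdu]] := ap _ (divr_gt0 e0 K0).
set e' := e / _ in fu fdu.
have e'0 : 0 < e' by rewrite divr_gt0.
have [Lf Lf'] := C1c_Lp p a b f p1 Cf.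
have [if_ _] := HC _ Lf; have [if' _] := HC _ Lf'.
have [iuf /(_ _ fu) uf] := HC _ (LpB p a b p1 _ _ Lu Lf).
have [iduf /(_ _ fdu) duf] := HC _ (LpB p a b p1 _ _ Ldu Lf').
have [ifh _] := mulb _ _ _ if_ ch' hM2; have [if'h _] := mulb _ _ _ if' ch hM1.
have [_ E1] := mulb _ _ _ iuf ch' hM2; have [_ E2] := mulb _ _ _ iduf ch hM1.
have F1 : \int[mu]_(x in D) ((u x - f x) * derive1 h x) =
    \int[mu]_(x in D) (u x * derive1 h x) - \int[mu]_(x in D) (f x * derive1 h x).
  by rewrite -RintegralB//; apply: eq_Rintegral => x _; rewrite mulrBl.
have F2 : \int[mu]_(x in D) ((du x - derive1 f x) * h x) =
    \int[mu]_(x in D) (du x * h x) - \int[mu]_(x in D) (derive1 f x * h x).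
  by rewrite -RintegralB//; apply: eq_Rintegral => x _; rewrite mulrBl.
have F3 := C1c_integration_by_parts a b f h Cf Ch.
(* By [F3] the contributions of [f] cancel, so only the approximation errors remain. *)
rewrite (_ : _ + _ = \int[mu]_(x in D) ((u x - f x) * derive1 h x) +
  \int[mu]_(x in D) ((du x - derive1 f x) * h x)); last by rewrite F1 F2 F3; ring.
apply: le_trans (ler_normD _ _) _; apply: le_trans (lerD E1 E2) _.
apply: (@le_trans _ _ (M2 * (C * e') + M1 * (C * e'))).
  by rewrite lerD// ler_wpM2l.
rewrite (_ : _ + _ = ((M1 + M2) * C) * e'); last by ring.
apply: (@le_trans _ _ (((M1 + M2) * C + 1) * e')).
  by rewrite ler_wpM2r ?lerDl// ltW.
by rewrite /e' mulrCA divff ?mulr1// gt_eqF.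
Qed.

Lemma W01p_pair_W01p u du : abs_continuous a b u ->
  W01p_pair p a b u du -> W01p p a b u.
Proof.
move=> au /[dup] W [Lu Ldu ap]; split => //; exists du.
  by split => //; exact: W01p_pair_weak_derivative.
move=> e e0; have [f Cf [fu fdu]] := ap _ (divr_gt0 e0 (ltr0n _ 2)).
by exists f => //; rewrite (splitr e) EFinD; exact: lteD.
Qed.

End W01p_pair_comp.

(** * The tent function and its product with [t + H] *)

Definition tent {R : realType} (H t : R) : R := Num.max 0 (Num.min (- t) (t + H)).

Section tent.
Context {R : realType}.
Implicit Types H x y t : R.

Lemma tent_ge0 H t : 0 <= tent H t.
Proof. by rewrite /tent le_max lexx. Qed.

Lemma tent_gt0 H t : - H < t -> t < 0 -> 0 < tent H t.
Proof. by move=> Ht t0; rewrite /tent lt_max lt_min; apply/orP; right; lra. Qed.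

Lemma tent_eq0 H t : t <= - H \/ 0 <= t -> tent H t = 0.
Proof.
by move=> h; apply/max_idPl; rewrite ge_min; apply/orP; case: h => h; [right|left]; lra.
Qed.

Lemma tent_le H t : 0 < H -> `|tent H t| <= H.
Proof.
move=> H0; rewrite ger0_norm ?tent_ge0// /tent ge_max (ltW H0)/= ge_min.
by have [t0|t0] := leP 0 t; apply/orP; [left|right]; lra.
Qed.

Lemma tent_lipschitz H x y : `|tent H x - tent H y| <= `|x - y|.
Proof.
wlog xy : x y / x <= y => [W|].
  have [xy|/ltW yx] := leP x y; first exact: W.
  by rewrite distrC (distrC x); exact: W.
rewrite (distrC x) (ger0_norm (_ : 0 <= y - x)) ?subr_ge0// ler_norml /tent.
have [a1|a1] := leP (- x) (x + H); have [a2|a2] := leP (- y) (y + H);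
  [have [a3|a3] := leP 0 (- x)|have [a3|a3] := leP 0 (- x)|
   have [a3|a3] := leP 0 (x + H)|have [a3|a3] := leP 0 (x + H)];
  [have [a4|a4] := leP 0 (- y)|have [a4|a4] := leP 0 (- y)|
   have [a4|a4] := leP 0 (y + H)|have [a4|a4] := leP 0 (y + H)|
   have [a4|a4] := leP 0 (- y)|have [a4|a4] := leP 0 (- y)|
   have [a4|a4] := leP 0 (y + H)|have [a4|a4] := leP 0 (y + H)];
  apply/andP; split; lra.
Qed.

(** The unbounded factor [t + H] is harmless: the tent vanishes outside [-H, 0], and inside both
    factors are at most [H]. *)
Lemma mul_tent_le H t : 0 < H -> `|(t + H) * tent H t| <= H * H.
Proof.
move=> H0; have [tH|tH] := leP t (- H).
  by rewrite tent_eq0; [rewrite mulr0 normr0 mulr_ge0// ltW|left].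
have [t0|t0] := leP 0 t.
  by rewrite tent_eq0; [rewrite mulr0 normr0 mulr_ge0// ltW|right].
rewrite normrM ler_pM// ?tent_le// ger0_norm; lra.
Qed.

(** By symmetry [x] may be taken in [-H, 0], where [t + H] is at most [H]; if neither point lies
    there, both products vanish. *)
Lemma mul_tent_lipschitz H x y : 0 < H ->
  `|(x + H) * tent H x - (y + H) * tent H y| <= (2 * H) * `|x - y|.
Proof.
move=> H0; wlog : x y / - H <= x /\ x <= 0 => [W|[Hx x0]].
  have [[Hx x0]|hx] := pselect (- H <= x /\ x <= 0); first exact: W.
  have [[Hy y0]|hy] := pselect (- H <= y /\ y <= 0).
    by rewrite distrC (distrC x); exact: W.
  have z t : ~ (- H <= t /\ t <= 0) -> tent H t = 0.
    move=> ht; apply: tent_eq0; have [tH|tH] := leP t (- H); first by left.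
    right; rewrite leNgt; apply/negP => t0; apply: ht; split; exact: ltW.
  by rewrite !z// !mulr0 subrr normr0 !mulr_ge0// ltW.
rewrite (_ : _ - _ = (x + H) * (tent H x - tent H y) + tent H y * (x - y)); last by ring.
rewrite (le_trans (ler_normD _ _))// !normrM mulr_natl mulr2n mulrDl lerD//.
  by rewrite ler_pM// ?tent_lipschitz// ger0_norm; lra.
by rewrite ler_wpM2r// tent_le.
Qed.

End tent.

(** * Continuity and primitives on the whole line *)

Lemma lipschitz_continuous {R : realType} (M : R) (g : R -> R) :
  (forall x y, `|g x - g y| <= M * `|x - y|) -> continuous g.
Proof.
move=> gM x; apply/cvgrPdist_lt => e e0.
have M0 : 0 < `|M| + 1 by rewrite ltr_wpDl.
exists (e / (`|M| + 1)); first by rewrite /= divr_gt0.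
move=> y /=; rewrite ltr_pdivlMr// mulrC; apply: le_lt_trans.
rewrite (le_trans (gM _ _))// ler_wpM2r// (le_trans (ler_norm M))//.
by rewrite lerDl.
Qed.

(** Vanishing to the left of [c] makes [g] integrable on every left half-line, so integrating from
    -oo gives one primitive valid at all points; a shift normalizes it at 0. *)
Lemma ex_primitive {R : realType} (c : R) (g : R -> R) : continuous g ->
  (forall x, x <= c -> g x = 0) ->
  exists2 G : R -> R, (forall x : R, is_derive x 1 G (g x)) & G 0 = 0.
Proof.
move=> cg g0.
pose F (x : R) := \int[lebesgue_measure]_(t in `]-oo, x]) g t.
have ig (u : R) : lebesgue_measure.-integrable `]-oo, u] (EFin \o g).
  rewrite (_ : EFin \o g = (EFin \o g) \_ `[c, +oo[); last first.
    apply/funext => x /=; rewrite patchE; case: ifPn => //.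
    rewrite notin_setE/= in_itv/= andbT => /negP; rewrite -ltNge => /ltW xc.
    by rewrite g0.
  apply/integrable_restrict => //.
  apply: integrableS (continuous_integrable_cc c u g cg) => //.
    exact: measurableI.
  by move=> x [] /=; rewrite !in_itv/= andbT => -> ->.
exists (fun x => F x - F 0); last by rewrite subrr.
move=> x; have x1 : x < x + 1 by rewrite ltrDl.
have [dF F'] := continuous_FTC1 x1 (ig _) (ltNyr _) (cg x).
have : is_derive x 1 F (g x) by rewrite -F' derive1E; exact: derivableP.
move=> dF'; rewrite -[g x]subr0; apply: is_deriveB.
Qed.

(** * The signed power z |-> |z|^(p-2) z *)

Section signed_power.
Context {R : realType}.
Implicit Types (p s y z : R).

(** One argument is a fixed [s > 0]. If [y <= 0] the signs decide; if [y > 0] the powers of [y] and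
    [s] are compared. *)
Lemma signed_power_monotone p s y : 2 < p -> 0 < s -> y != s ->
  0 < (`|y| `^ (p - 2) * y - `|s| `^ (p - 2) * s) * (y - s).
Proof.
move=> p2 s0 ys; rewrite (gtr0_norm s0).
have sp : 0 < s `^ (p - 2) by exact: powR_gt0.
have p20 : 0 <= p - 2 by lra.
have [ylt|ygt|yE] := ltgtP y s; last by rewrite yE eqxx in ys.
- rewrite nmulr_rgt0 ?subr_lt0//.
  have [y0|y0] := leP y 0.
    by rewrite (@le_lt_trans _ _ 0)// ?mulr_gt0// mulr_ge0_le0// powR_ge0.
  rewrite (gtr0_norm y0) (@le_lt_trans _ _ (s `^ (p - 2) * y))//.
    by rewrite ler_wpM2r ?(ltW y0)// ge0_ler_powR ?nnegrE// ?ltW.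
  by rewrite ltr_pM2l.
- have y0 : 0 < y by exact: lt_trans ygt.
  rewrite mulr_gt0 ?subr_gt0// (gtr0_norm y0).
  rewrite (@lt_le_trans _ _ (s `^ (p - 2) * y))// ?ltr_pM2l//.
  by rewrite ler_wpM2r ?(ltW y0)// ge0_ler_powR ?nnegrE// ?ltW.
Qed.

(** With [m] the larger of the two absolute values, the product is at most [m ^ p], which is one of
    the two summands. This provides the integrable majorant of the weak form. *)
Lemma powR_young p y z : 2 < p ->
  `|y| `^ (p - 2) * `|y| * `|z| <= `|y| `^ p + `|z| `^ p.
Proof.
move=> p2; pose m := Num.max `|y| `|z|.
have m0 : 0 <= m by rewrite le_max normr_ge0.
have ym : `|y| <= m by rewrite le_max lexx.
have zm : `|z| <= m by rewrite le_max lexx orbT.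
apply: (@le_trans _ _ (m `^ p)).
  rewrite -(mulr_powRB1 m0 (_ : 0 < p)); last by lra.
  rewrite -(mulr_powRB1 m0 (_ : 0 < p - 1)); last by lra.
  rewrite (_ : p - 1 - 1 = p - 2); last by ring.
  rewrite [leRHS]mulrC [m * _]mulrC ler_pM ?mulr_ge0 ?powR_ge0//.
  rewrite ler_pM ?powR_ge0// ge0_ler_powR ?nnegrE//; lra.
by rewrite /m; have [_|_] := leP `|y| `|z|; rewrite ?lerDl ?lerDr powR_ge0.
Qed.

End signed_power.

(** * Integrands of constant sign *)

Lemma Rintegral_ae_le0 d (T : measurableType d) (R : realType)
    (mu : {measure set T -> \bar R}) (A : set T) (k l : T -> R) :
  measurable A -> measurable_fun A k -> measurable_fun A l ->
  {ae mu, forall x, A x -> 0 <= k x} -> (forall x, A x -> l x <= 0) ->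
  \int[mu]_(x in A) (k x * l x) <= 0.
Proof.
move=> mA mk ml k0 l0.
(* Passing to the absolute value of [k] alters a null set only and makes the integrand nonpositive
   on all of [A]. Its positive part is then 0, and [fine] preserves the sign even of -oo. *)
rewrite /Rintegral (@ae_eq_integral _ _ _ mu A (fun x => (`|k x| * l x)%:E))//.
- apply: fine_le0; rewrite integralE integral0_eq; last first.
    move=> x Ax; rewrite funeposE; apply/max_idPr.
    by rewrite lee_fin mulr_ge0_le0// l0.
  by rewrite sub0e oppe_le0 integral_ge0.
- exact/measurable_EFinP/measurable_funM.
- by apply/measurable_EFinP/measurable_funM => //; exact: measurableT_comp.
- by apply: filterS k0 => x kx Ax; rewrite ger0_norm// kx.
Qed.

Lemma Rintegral_le0_ae_eq0 d (T : measurableType d) (R : realType)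
    (mu : {measure set T -> \bar R}) (A : set T) (k : T -> R) :
  measurable A -> mu.-integrable A (EFin \o k) ->
  (forall x, A x -> 0 <= k x) -> \int[mu]_(x in A) k x <= 0 ->
  {ae mu, forall x, A x -> k x = 0}.
Proof.
move=> mA ik k0 ik0.
have mk : measurable_fun A (EFin \o k) by case/integrableP : ik.
have I0 : (\int[mu]_(x in A) `|(EFin \o k) x| = 0)%E.
  rewrite (@eq_integral _ _ _ _ _ (EFin \o k)); last first.
    by move=> x /[!inE] Ax /=; rewrite ger0_norm// k0.
  rewrite -[LHS]fineK; last exact: integrable_fin_num.
  congr EFin; apply/eqP; rewrite eq_le ik0/=.
  by apply: fine_ge0; apply: integral_ge0 => x Ax; rewrite lee_fin k0.
have := (ae_eq_integral_abs mu mA mk).1 I0.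
by apply: filterS => x h Ax; have [] := h Ax.
Qed.

(** * Testing the equation with [G \o u], and nonnegativity of [u] *)

Theorem proposition3p19 (R : realType) (p H phi : R) (f u : R -> R)
  (hp : 2 < p) (hH : 0 < H) (hphi0 : 0 < phi) (hphi1 : phi < pi / 2)
  (hf : (@lebesgue_measure R).-integrable `]-1, 1[ (EFin \o f))
  (hu : weak_solution p H phi f u)
  (hf0 : {ae @lebesgue_measure R, forall x : R, x \in `]-1, 1[ -> 0 <= f x}) :
  forall x : R, x \in `]-1, 1[ -> 0 <= u x.
Proof.
pose D := `](-1), (1:R)[%classic.
have p1 : 1 < p by lra.
have mD : measurable (D : set (measurableTypeR R)) by exact: measurable_itv.
have s0 : 0 < sin phi by apply: sin_gt0_pihalf; rewrite hphi0.
have c0 : 0 < cos phi.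
  by apply: cos_gt0_pihalf; rewrite hphi1 andbT; have := pi_gt0 R; lra.
case: hu => W uH sol.
have au : abs_continuous (-1) 1 u by case: W.
have cu := abs_continuous_continuous _ _ _ au.
have [du wdu P] := W01p_pairP _ _ _ _ W.
have [Lu Ldu _] := P.
pose g := tent H; pose k t := (t + H) * g t.
have gM t : `|g t| <= H by exact: tent_le.
have gL x y : `|g x - g y| <= 1 * `|x - y| by rewrite mul1r tent_lipschitz.
have kM t : `|k t| <= H * H by exact: mul_tent_le.
have kL x y : `|k x - k y| <= 2 * H * `|x - y| by exact: mul_tent_lipschitz.
have cg := lipschitz_continuous _ _ gL; have ck := lipschitz_continuous _ _ kL.
have g0 t : t <= - H -> g t = 0 by move=> tH; apply: tent_eq0; left.
have k0 t : t <= - H -> k t = 0 by move=> tH; rewrite /k g0// mulr0.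
have [G dG G0] := ex_primitive _ _ cg g0.
have [K dK K0] := ex_primitive _ _ ck k0.
have PG := W01p_pair_comp _ _ _ p1 _ _ _ _ _ _ dG G0 gM gL cg cu P.
have PK := W01p_pair_comp _ _ _ p1 _ _ _ _ _ _ dK K0 kM kL ck cu P.
have derc (F F' : R -> R) : (forall x : R, is_derive x 1 F (F' x)) ->
    forall x y, {within `[x, y], continuous F}.
  by move=> dF x y; apply: derivable_within_continuous => z _; have [] := dF z.
(* By the mean value theorem: [g >= 0] gives the sign for negative [t], and [g] vanishes on the
   positive axis. *)
have Gle0 t : G t <= 0.
  have [t0|t0|->] := ltgtP t 0; last by rewrite G0.
    have [c _] := MVT t0 (fun z _ => dG z) (derc _ _ dG t 0).
    have := tent_ge0 H c; rewrite -/g G0 !sub0r => gc E.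
    by rewrite -oppr_ge0 E mulr_ge0// oppr_ge0 ltW.
  have [c + E] := MVT t0 (fun z _ => dG z) (derc _ _ dG 0 t).
  rewrite in_itv/= => /andP[c00 _]; move: E; rewrite G0 !subr0 => ->.
  by rewrite /g tent_eq0 ?mul0r//; right; exact: ltW.
have Gabs : abs_continuous (-1) 1 (G \o u).
  exact: abs_continuous_comp (is_derive_lipschitz _ _ _ dG gM) au.
have eq := sol du wdu _ _ (W01p_pair_W01p _ _ _ p1 _ _ Gabs PG)
  (W01p_pair_weak_derivative _ _ _ p1 _ _ PG).
have [LGu LgGu _] := PG; have [LKu LkKu _] := PK.
have mG := ((LpP _ _ _ _).1 LGu).1.
have mf : measurable_fun D f by case/integrableP : hf => /measurable_EFinP.
have rhs : \int[lebesgue_measure]_(x in D) (f x * (G \o u) x) <= 0.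
  apply: Rintegral_ae_le0 => //.
  by move=> x _; exact: Gle0.
rewrite -eq in rhs.
pose y x := du x * cos phi + sin phi.
pose Phi (z : R) := `|z| `^ (p - 2) * z.
pose Q x := k (u x) * ((Phi (y x) - Phi (sin phi)) * du x).
have Ly : Lp p (-1) 1 y.
  apply: LpD => //; last exact: Lp_cst.
  have := LpZ p (-1) 1 p1 (cos phi) _ Ldu.
  by under eq_fun do rewrite mulrC.
have my := ((LpP _ _ _ _).1 Ly).1.
have mdu := ((LpP _ _ _ _).1 Ldu).1.
have mk : measurable_fun D (k \o u).
  apply: measurableT_comp; first exact: continuous_measurable_fun.
  exact: ((LpP _ _ _ _).1 Lu).1.
have mPhi : measurable_fun D (fun x => Phi (y x)).
  by apply: measurable_funM => //; exact: measurable_norm_powR.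
(* Dominated by [H * H] times the sum of the p-th powers of [y] and [du], through [kM] and
   [powR_young]. *)
have iE : lebesgue_measure.-integrable D
    (EFin \o (fun x => k (u x) * (Phi (y x) * du x))).
  have iy := Lp_integrable_powR _ _ _ p1 _ Ly.
  have idu := Lp_integrable_powR _ _ _ p1 _ Ldu.
  have := integrableZl mD (H * H) (integrableD mD iy idu).
  apply: le_integrable => //.
    apply/measurable_EFinP; apply: measurable_funM => //.
    exact: measurable_funM.
  move=> x Dx /=; rewrite lee_fin [leRHS]ger0_norm; last first.
    by apply: mulr_ge0; [rewrite mulr_ge0// ltW|rewrite addr_ge0 ?powR_ge0].
  rewrite normrM ler_pM//.
  by rewrite /Phi !normrM (ger0_norm (powR_ge0 _ _)) powR_young.
have [C _ HC] := Lp_norm_L1 p (-1) 1 p1.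
have [ik _] := HC _ LkKu.
have QE x : Q x = k (u x) * (Phi (y x) * du x) - Phi (sin phi) * (k (u x) * du x).
  by rewrite /Q; ring.
have ick : lebesgue_measure.-integrable D
    (EFin \o (fun x => Phi (sin phi) * (k (u x) * du x))).
  exact: integrableZl ik.
have iQ : lebesgue_measure.-integrable D (EFin \o Q).
  by apply: eq_integrable (integrableB mD iE ick) => // x _ /=; rewrite QE.
(* As [cos phi > 0], [du x] has the sign of [y x - sin phi], which is what monotonicity of [Phi]
   calls for. *)
have duE x : du x = (y x - sin phi) / cos phi.
  by rewrite /y addrK mulfK// gt_eqF.
have ku0 x : D x -> 0 <= k (u x).
  by move=> Dx; rewrite mulr_ge0 ?tent_ge0// -lerBlDr sub0r uH.
have Phi_du x : du x != 0 -> 0 < (Phi (y x) - Phi (sin phi)) * du x.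
  move=> dx0; have ys : y x != sin phi.
    by apply: contra dx0 => /eqP ys; rewrite duE ys subrr mul0r.
  by rewrite [in X in _ * X]duE mulrA divr_gt0// signed_power_monotone.
have Q0 x : D x -> 0 <= Q x.
  move=> Dx; rewrite /Q mulr_ge0 ?ku0//.
  by have [->|/Phi_du/ltW//] := eqVneq (du x) 0; rewrite mulr0.
have N1 : -1 < 1 :> R by lra.
(* The subtracted term is a multiple of the derivative of [K \o u], of integral 0; what is left is
   the tested left-hand side, nonpositive by [rhs]. *)
have intQ : \int[lebesgue_measure]_(x in D) Q x <= 0.
  under eq_Rintegral do rewrite QE.
  rewrite RintegralB//.
  rewrite RintegralZl// (W01p_pair_Rintegral0 _ _ _ p1 _ _ N1 PK) mulr0 subr0.
  apply: le_trans rhs; rewrite le_eqVlt; apply/orP; left; apply/eqP.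
  by apply: eq_Rintegral => x _; rewrite /k /Phi /y; ring.
have aeQ := Rintegral_le0_ae_eq0 _ _ _ lebesgue_measure _ _ mD iQ Q0 intQ.
(* Where [du x] is nonzero, the second factor of [Q x] is positive, so [Q x = 0] forces
   [k (u x) = 0]. *)
have aek : {ae lebesgue_measure, forall x, D x -> k (u x) * du x = 0}.
  apply: filterS aeQ => x Qx0 Dx; have [->|dx0] := eqVneq (du x) 0.
    by rewrite mulr0.
  have /eqP := Qx0 Dx; rewrite /Q mulf_eq0 (gt_eqF (Phi_du _ dx0)) orbF => /eqP ->.
  by rewrite mul0r.
have Ku x : D x -> K (u x) = 0.
  move=> Dx.
  have cKu := abs_continuous_continuous _ _ _
    (abs_continuous_comp _ _ _ _ _ (is_derive_lipschitz _ _ _ dK kM) au).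
  rewrite [LHS](W01p_pair_primitive _ _ _ p1 _ _ PK cKu _ Dx).
  have sub : `]-1, x[ `<=` D.
    apply: subset_itvl; rewrite bnd_simp.
    by move: Dx; rewrite /D/= in_itv/= => /andP[_ /ltW].
  rewrite /Rintegral (@ae_eq_integral _ _ _ lebesgue_measure _ (cst 0%E)) ?integral0//.
    apply: measurable_funS sub _ => //.
    by case/integrableP : ik.
  apply: (@filterS _ _ (ae_filter_ringOfSetsType lebesgue_measure)) aek.
  by move=> t kt /sub Dt; rewrite kt.
(* If [u x < 0], the mean value theorem for [K] between [u x] and 0 gives a zero of [k] at some [c]
   with [- H < c < 0], where [k] is positive. *)
move=> x Dx; rewrite leNgt; apply/negP => ux.
have [c] := MVT ux (fun z _ => dK z) (derc _ _ dK (u x) 0).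
rewrite Ku// K0 subrr sub0r in_itv/= => /andP[uc c00] E.
have : 0 < k c * - u x.
  have Huc : - H < c by exact: le_lt_trans (uH _ Dx) uc.
  rewrite mulr_gt0 ?oppr_gt0// /k mulr_gt0 ?tent_gt0//; lra.
by rewrite -E ltxx.
Qed.
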